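(* Let $c:[0,\infty)\to\mathbb{R}$ be continuous and strictly increasing and let $\epsilon\in(0,1)$. For $\lambda>0$ let $F_\lambda$ be the problem $\min_{\beta\ge0} c(\beta)$ subject to $\tilde\alpha(\beta,\lambda)\le\epsilon$, and let $G_\lambda$ be the problem $\min_{\beta\ge0} c(\beta)$ subject to $UB(\beta,\lambda)\le\epsilon$. Then for every $\lambda>0$ both problems have (unique) optimal solutions $\beta^F_\lambda$ and $\beta^G_\lambda$, these satisfy $\beta^G_\lambda\ge\beta^F_\lambda$, and there is a finite $\beta^*$ with $$\lim_{\lambda\to\infty}\beta^G_\lambda=\lim_{\lambda\to\infty}\beta^F_\lambda=\beta^*.$$
   Context: $\phi,\Phi$ are the standard normal density and distribution function. For $\lambda>0$ and real $n\ge 0$, $\bar\alpha(n,\lambda)=\min\Big\{1,\big[\lambda\int_0^\infty t e^{-\lambda t}(1+t)^{n-1}\,dt\big]^{-1}\Big\}$ is the continuous Erlang-C function, and $\tilde\alpha(\beta,\lambda)=\bar\alpha(\lambda+\beta\sqrt\lambda,\lambda)$. For $\lambda>0,\beta\ge 0$ set $n=\lambda+\beta\sqrt{\lambda}$, $\rho=\lambda/n$, $a=\sqrt{-2n(1-\rho+\ln\rho)}$, $\gamma=(n-\lambda)/\sqrt{n}$, and $UB(\beta,\lambda)=\left[\rho+\gamma\left(\frac{\Phi(a)}{\phi(a)}+\frac{2}{3\sqrt{n}}\right)\right]^{-1}$. It is known (Janssen, van Leeuwaarden and Zwart) that $\tilde\alpha(\beta,\lambda)\le UB(\beta,\lambda)$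 for all $\lambda,\beta>0$. *)

(* Defs.v *)
From Stdlib Require Import Reals Lra ClassicalEpsilon.
Open Scope R_scope.

Definition int_ab (f : R -> R) (a b v : R) : Prop :=
  exists pr : Riemann_integrable f a b, RiemannInt pr = v.

Definition improper_int_to_inf (f : R -> R) (a l : R) : Prop :=
  forall eps, eps > 0 -> exists M, forall b, b >= M ->
    exists v, int_ab f a b v /\ Rabs (v - l) < eps.

Definition improper_int_from_minf (f : R -> R) (a l : R) : Prop :=
  forall eps, eps > 0 -> exists M, forall b, b <= M ->
    exists v, int_ab f b a v /\ Rabs (v - l) < eps.

(* values (limits are unique, so these are well defined when they exist) *)
Definition Int_to_inf (f : R -> R) (a : R) : R :=
  epsilon (inhabits 0) (improper_int_to_inf f a).
Definition Int_from_minf (f : R -> R) (a : R) : R :=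
  epsilon (inhabits 0) (improper_int_from_minf f a).

Definition phi (x : R) : R := exp (- x ^ 2 / 2) / sqrt (2 * PI).
Definition Phi (x : R) : R := Int_from_minf phi x.

(* continuous Erlang-C function alpha_bar(n, lambda) *)
Definition alpha_bar (n lam : R) : R :=
  Rmin 1 (/ (lam * Int_to_inf
                     (fun t => t * exp (- lam * t) * Rpower (1 + t) (n - 1)) 0)).

Definition alpha_tilde (beta lam : R) : R :=
  alpha_bar (lam + beta * sqrt lam) lam.

Definition UB (beta lam : R) : R :=
  let n := lam + beta * sqrt lam in
  let rho := lam / n in
  let a := sqrt (- 2 * n * (1 - rho + ln rho)) in
  let gam := (n - lam) / sqrt n in
  / (rho + gam * (Phi a / phi a + 2 / (3 * sqrt n))).

Definition is_optimal (c : R -> R) (feas : R -> Prop) (beta : R) : Prop :=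
  0 <= beta /\ feas beta /\
  (forall beta', 0 <= beta' -> feas beta' -> c beta <= c beta').

Definition continuous_on_nonneg (c : R -> R) : Prop :=
  forall x, 0 <= x -> forall eps, eps > 0 -> exists delta, delta > 0 /\
    forall y, 0 <= y -> Rabs (y - x) < delta -> Rabs (c y - c x) < eps.

Definition strictly_increasing_on_nonneg (c : R -> R) : Prop :=
  forall x y, 0 <= x -> x < y -> c x < c y.

Definition lim_at_infty (f : R -> R) (l : R) : Prop :=
  forall eps, eps > 0 -> exists M, forall lam, lam >= M -> Rabs (f lam - l) < eps.

(* Main.v *)
(** With n = lam + b sqrt lam, the Erlang integral I = lam * int t e^(-lam t) (1+t)^(n-1)
    integrates by parts to 1 + (n - lam) J, where J = int e^(-lam t) (1+t)^(n-1).
    Put u = lam (1+t) / n and x = +- sqrt (2n (u - 1 - ln u)), with the sign of u - 1;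
    then the integrand of J becomes a Gaussian in x times a factor pinched by
    9 (u-1)^2 / (u+2)^2 <= 2 (u - 1 - ln u) <= (u-1)^2 / min (1, u).  The left inequality
    gives 1 / UB <= I, and the right one gives I <= H b := 1 + b Phi b / phi b for every
    lam.  Let H b* = 1 / eps.  By the second bound no b < b* is feasible for F, and by the
    first the G-optimum is F-feasible, so b* <= betaF <= betaG; finally 1 / UB (b, lam)
    tends to H b > 1 / eps for each fixed b > b*, so betaG -> b*.  The minima exist because
    1 / UB is continuous and unbounded in b, while I is convex in n. *)

Require Import Defs.
From Stdlib Require Import Reals Lra ClassicalEpsilon.
From Coquelicot Require Import Coquelicot.
Open Scope R_scope.

(** * Monotonicity from the derivative, and bounds on u - 1 - ln u *)

(** The derivative is asked for only inside the interval and continuity up to its ends, because the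
    comparison functions below lose differentiability at one endpoint, where u = 1. *)
Lemma le_of_derive_nonneg (f df : R -> R) (a b : R) :
  a <= b ->
  (forall x, a < x < b -> is_derive f x (df x)) ->
  (forall x, a <= x <= b -> continuous f x) ->
  (forall x, a < x < b -> 0 <= df x) ->
  f a <= f b.
Proof.
intros [hab | <-] hd hc hp; [|lra].
assert (pr1 : forall c, a < c < b -> derivable_pt f c).
{ intros c hc'; exists (df c); apply is_derive_Reals; auto. }
assert (pr2 : forall c, a < c < b -> derivable_pt id c)
  by (intros; apply derivable_pt_id).
destruct (MVT f id a b pr1 pr2 hab) as [c [hcab E]].
- intros x hx; apply continuity_pt_filterlim, hc, hx.
- intros x _; apply derivable_continuous_pt, derivable_pt_id.
- assert (D1 : derive_pt f c (pr1 c hcab) = df c).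
  { apply derive_pt_eq_0, is_derive_Reals, hd, hcab. }
  assert (D2 : derive_pt id c (pr2 c hcab) = 1).
  { apply derive_pt_eq_0, derivable_pt_lim_id. }
  rewrite D1, D2 in E; unfold id in E.
  assert (0 <= (b - a) * df c) by (apply Rmult_le_pos; [lra | auto]).
  lra.
Qed.

Lemma le_of_is_derive_nonneg (f df : R -> R) (a b : R) :
  a <= b ->
  (forall x, a <= x <= b -> is_derive f x (df x)) ->
  (forall x, a <= x <= b -> 0 <= df x) ->
  f a <= f b.
Proof.
intros hab hd hp.
apply (le_of_derive_nonneg f df); auto.
- intros x hx; apply hd; lra.
- intros x hx; apply (ex_derive_continuous f); exists (df x); auto.
- intros x hx; apply hp; lra.
Qed.

Lemma cube_am_gm (u : R) : 0 < u -> 27 * u <= (u + 2) ^ 3.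
Proof.
intros hu.
assert (E : (u + 2) ^ 3 - 27 * u = (u - 1) ^ 2 * (u + 8)) by ring.
assert (0 <= (u - 1) ^ 2 * (u + 8)) by (apply Rmult_le_pos; [apply pow2_ge_0 | lra]).
lra.
Qed.

(** The difference [f] of the two sides vanishes at 1, and its derivative is u - 1 times a factor
    that [cube_am_gm] (AM-GM for u, 1, 1) makes nonnegative; hence 1 is its minimum on the positive
    axis. *)
Lemma sub_ln_lower (u : R) :
  0 < u -> 9 * (u - 1) ^ 2 / (u + 2) ^ 2 <= 2 * (u - 1 - ln u).
Proof.
intros hu.
pose (f := fun u => 2 * (u - 1 - ln u) - 9 * (u - 1) ^ 2 / (u + 2) ^ 2).
pose (k := fun u => (u + 2) ^ 3 - 27 * u).
assert (hd : forall x, 0 < x ->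
  is_derive f x ((x - 1) * (2 * k x / (x * (x + 2) ^ 3)))).
{ intros x hx; unfold f, k; auto_derive.
  - repeat split; auto; nra.
  - field; lra. }
assert (hk : forall x, 0 < x -> 0 <= 2 * k x / (x * (x + 2) ^ 3)).
{ intros x hx; pose proof (cube_am_gm x hx).
  apply Rle_mult_inv_pos; [unfold k; lra|].
  apply Rmult_lt_0_compat; [lra | apply pow_lt; lra]. }
assert (f1 : f 1 = 0) by (unfold f; rewrite ln_1; field).
enough (0 <= f u) by (unfold f in *; lra).
destruct (Rle_dec 1 u) as [h | h].
- rewrite <- f1; eapply le_of_is_derive_nonneg; [lra | |].
  + intros x hx; apply hd; lra.
  + intros x hx; apply Rmult_le_pos; [lra | apply hk; lra].
- enough (- f u <= - f 1) by lra.
  apply (le_of_is_derive_nonneg (fun x => - f x)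
    (fun x => - ((x - 1) * (2 * k x / (x * (x + 2) ^ 3))))); [lra | |].
  + intros x hx; apply (is_derive_opp f); apply hd; lra.
  + intros x hx; pose proof (hk x ltac:(lra)); nra.
Qed.

Lemma sub_ln_nonneg (u : R) : 0 < u -> 0 <= u - 1 - ln u.
Proof.
intros hu; pose proof (sub_ln_lower u hu).
enough (0 <= 9 * (u - 1) ^ 2 / (u + 2) ^ 2) by lra.
apply Rle_mult_inv_pos; [pose proof (pow2_ge_0 (u - 1)); lra | apply pow_lt; lra].
Qed.

Lemma sub_ln_upper_ge1 (u : R) : 1 <= u -> 2 * (u - 1 - ln u) <= (u - 1) ^ 2.
Proof.
intros hu.
pose (f := fun u => (u - 1) ^ 2 - 2 * (u - 1 - ln u)).
enough (f 1 <= f u) by (unfold f in *; rewrite ln_1 in *; lra).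
apply (le_of_is_derive_nonneg f (fun x => 2 * (x - 1) ^ 2 / x)); auto.
- intros x hx; unfold f; auto_derive; [lra | field; lra].
- intros x hx; apply Rle_mult_inv_pos; [|lra].
  pose proof (pow2_ge_0 (x - 1)); lra.
Qed.

(** To the left of 1 the bare square is too small; after division by u the difference has derivative
    (1 - 1/u)^2, so it increases to its value 0 at 1. *)
Lemma sub_ln_upper_le1 (u : R) :
  0 < u <= 1 -> 2 * (u - 1 - ln u) <= (u - 1) ^ 2 / u.
Proof.
intros [h0 h1].
pose (f := fun u => 2 * (u - 1 - ln u) - (u - 1) ^ 2 / u).
enough (f u <= f 1) by (unfold f in *; rewrite ln_1 in *; lra).
apply (le_of_is_derive_nonneg f (fun x => (1 - / x) ^ 2)); auto.
- intros x hx; unfold f; auto_derive; [lra | field; lra].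
- intros x hx; apply pow2_ge_0.
Qed.

(** * The Gaussian integral and the ratio Phi / phi *)

(** The normal density without the factor 1 / sqrt (2 PI), which cancels in Phi / phi. *)
Definition gauss (s : R) : R := exp (- s ^ 2 / 2).
Definition gauss_int (x : R) : R := RInt gauss 0 x.

Lemma gauss_pos (x : R) : 0 < gauss x.
Proof. apply exp_pos. Qed.

Lemma continuous_gauss (x : R) : continuous gauss x.
Proof.
apply (ex_derive_continuous gauss); unfold gauss; auto_derive; auto.
Qed.

Lemma ex_RInt_gauss (a b : R) : ex_RInt gauss a b.
Proof.
apply (ex_RInt_continuous (V := R_CompleteNormedModule) gauss).
intros; apply continuous_gauss.
Qed.

Lemma is_derive_gauss_int (x : R) : is_derive gauss_int x (gauss x).
Proof.
apply (is_derive_RInt gauss gauss_int 0 x); [|apply continuous_gauss].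
apply filter_forall; intros y; apply (RInt_correct gauss), ex_RInt_gauss.
Qed.

Lemma continuous_gauss_int (x : R) : continuous gauss_int x.
Proof.
apply (ex_derive_continuous gauss_int); eexists; apply is_derive_gauss_int.
Qed.

Lemma gauss_int_0 : gauss_int 0 = 0.
Proof. apply (RInt_point 0 gauss). Qed.

Lemma gauss_int_le (x y : R) : x <= y -> gauss_int x <= gauss_int y.
Proof.
intros h; apply (le_of_is_derive_nonneg gauss_int gauss); auto.
- intros; apply is_derive_gauss_int.
- intros; left; apply gauss_pos.
Qed.

Lemma gauss_int_opp (x : R) : gauss_int (- x) = - gauss_int x.
Proof.
assert (H : is_RInt gauss (- 0) (- x) (gauss_int (- x))).
{ rewrite Ropp_0; apply (RInt_correct gauss), ex_RInt_gauss. }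
apply is_RInt_comp_opp in H.
rewrite <- (is_RInt_unique _ _ _ _ H).
apply is_RInt_unique.
apply (is_RInt_ext (fun y => opp (gauss y))).
- intros y _; unfold gauss; now replace ((- y) ^ 2) with (y ^ 2) by ring.
- apply (is_RInt_opp gauss), (RInt_correct gauss), ex_RInt_gauss.
Qed.

(** From (y - 1)^2 >= 0 comes - y^2 / 2 <= 1/2 - y, and exp (1/2 - y) has integral exp (1/2) over
    the positive half-line. *)
Lemma gauss_int_bound (x : R) : gauss_int x <= exp (1 / 2).
Proof.
destruct (Rle_dec x 0) as [h | h].
- pose proof (gauss_int_le x 0 h); rewrite gauss_int_0 in *.
  pose proof (exp_pos (1 / 2)); lra.
- pose (f := fun x => - exp (1 / 2 - x) - gauss_int x).
  assert (H : f 0 <= f x).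
  { apply (le_of_is_derive_nonneg f (fun x => exp (1 / 2 - x) - gauss x)); [lra | |].
    - intros y hy; unfold f.
      apply (is_derive_minus (fun x => - exp (1 / 2 - x)) gauss_int).
      + auto_derive; auto; unfold Rminus; field.
      + apply is_derive_gauss_int.
    - intros y hy; unfold gauss.
      enough (exp (- y ^ 2 / 2) <= exp (1 / 2 - y)) by lra.
      assert (H : - y ^ 2 / 2 <= 1 / 2 - y).
      { pose proof (pow2_ge_0 (y - 1)) as h2.
        replace ((y - 1) ^ 2) with (y ^ 2 - 2 * y + 1) in h2 by ring; lra. }
      destruct H as [H | ->]; [left; apply exp_increasing, H | apply Rle_refl]. }
  unfold f in H; rewrite gauss_int_0, !Rminus_0_r in H.
  pose proof (exp_pos (1 / 2 - x)); lra.
Qed.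

Lemma gauss_half_exists :
  { G : R | is_lub (fun y => exists x, y = gauss_int x) G }.
Proof.
apply completeness.
- exists (exp (1 / 2)); intros y [x ->]; apply gauss_int_bound.
- exists (gauss_int 0), 0; reflexivity.
Qed.

(** The integral of [gauss] over the positive half-line, taken as the supremum of the increasing
    function [gauss_int]. *)
Definition gauss_half : R := proj1_sig gauss_half_exists.

Lemma gauss_int_le_half (x : R) : gauss_int x <= gauss_half.
Proof.
unfold gauss_half; destruct gauss_half_exists as [G [h1 h2]]; simpl.
apply h1; exists x; reflexivity.
Qed.

(** Since [gauss_int] increases, a bound at arbitrarily large points bounds the supremum. Estimates
    at finite b pass to the limit in this form. *)
Lemma gauss_half_le (B : R) :
  (forall x, exists y, x <= y /\ gauss_int y <= B) -> gauss_half <= B.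
Proof.
intros H; unfold gauss_half; destruct gauss_half_exists as [G [h1 h2]]; simpl.
apply h2; intros y [x ->].
destruct (H x) as [z [hz hB]]; pose proof (gauss_int_le x z hz); lra.
Qed.

Lemma gauss_half_pos : 0 < gauss_half.
Proof.
apply Rlt_le_trans with (gauss_int 1); [|apply gauss_int_le_half].
unfold gauss_int; apply RInt_gt_0; [lra | |].
- intros; apply gauss_pos.
- intros; apply continuous_gauss.
Qed.

Lemma gauss_int_cv (e : R) :
  0 < e -> exists m, forall x, m <= x -> gauss_half - e < gauss_int x.
Proof.
intros he; apply NNPP; intros hn.
enough (gauss_half <= gauss_half - e) by lra.
apply gauss_half_le; intros x.
apply NNPP; intros hx; apply hn; exists x; intros y hy.
apply Rnot_le_lt; intros h; apply hx; exists y; auto.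
Qed.

(** The ratio Phi a / phi a, that is, the Mills ratio of the normal law at - a; see
    [Phi_div_phi]. *)
Definition mills (a : R) : R := exp (a ^ 2 / 2) * (gauss_half + gauss_int a).

Lemma mills_ge_half (a : R) : 0 <= a -> gauss_half <= mills a.
Proof.
intros ha; unfold mills; pose proof gauss_half_pos.
pose proof (gauss_int_le 0 a ha); rewrite gauss_int_0 in *.
pose proof (exp_ineq1_le (a ^ 2 / 2)); pose proof (pow2_ge_0 a).
nra.
Qed.

Lemma mills_le (a b : R) : 0 <= a -> a <= b -> mills a <= mills b.
Proof.
intros ha hab; unfold mills; pose proof gauss_half_pos.
pose proof (gauss_int_le 0 a ha); rewrite gauss_int_0 in *.
pose proof (gauss_int_le a b hab).
apply Rmult_le_compat; [left; apply exp_pos | lra | | lra].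
destruct hab as [hab | ->]; [left; apply exp_increasing; nra | lra].
Qed.

Lemma continuous_mills (a : R) : continuous mills a.
Proof.
unfold mills; apply (continuous_mult (fun a => exp (a ^ 2 / 2))).
- apply (ex_derive_continuous (fun a => exp (a ^ 2 / 2))); auto_derive; auto.
- apply (continuous_plus (fun _ => gauss_half) gauss_int);
    [apply continuous_const | apply continuous_gauss_int].
Qed.

(** * Improper integrals as limits, and the normal distribution function *)

Lemma is_RInt_int_ab (f : R -> R) (a b v : R) : is_RInt f a b v -> int_ab f a b v.
Proof.
intros H; assert (pr : Riemann_integrable f a b)
  by (apply ex_RInt_Reals_0; exists v; exact H).
exists pr; rewrite <- RInt_Reals; apply is_RInt_unique, H.
Qed.

Lemma int_ab_unique (f : R -> R) (a b v w : R) :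
  int_ab f a b v -> int_ab f a b w -> v = w.
Proof. intros [p <-] [p' <-]; apply RiemannInt_P5. Qed.

(** The value chosen by [epsilon] is some limit; beyond both thresholds it and l are within e / 2 of
    the same proper integral, so they agree. *)
Lemma Int_to_inf_eq (f : R -> R) (a l : R) :
  improper_int_to_inf f a l -> Int_to_inf f a = l.
Proof.
intros H; unfold Int_to_inf.
pose proof (epsilon_spec (inhabits 0) (improper_int_to_inf f a) (ex_intro _ l H)) as H'.
set (l' := epsilon _ _) in *.
apply cond_eq; intros e he.
destruct (H (e / 2) ltac:(lra)) as [m hm]; destruct (H' (e / 2) ltac:(lra)) as [m' hm'].
destruct (hm _ (Rle_ge _ _ (Rmax_l m m'))) as [v [hv hl]].
destruct (hm' _ (Rle_ge _ _ (Rmax_r m m'))) as [v' [hv' hl']].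
rewrite (int_ab_unique _ _ _ _ _ hv' hv) in hl'.
apply Rabs_def2 in hl; apply Rabs_def2 in hl'; apply Rabs_def1; lra.
Qed.

Lemma Int_from_minf_eq (f : R -> R) (a l : R) :
  improper_int_from_minf f a l -> Int_from_minf f a = l.
Proof.
intros H; unfold Int_from_minf.
pose proof (epsilon_spec (inhabits 0) (improper_int_from_minf f a) (ex_intro _ l H)) as H'.
set (l' := epsilon _ _) in *.
apply cond_eq; intros e he.
destruct (H (e / 2) ltac:(lra)) as [m hm]; destruct (H' (e / 2) ltac:(lra)) as [m' hm'].
destruct (hm _ (Rmin_l m m')) as [v [hv hl]].
destruct (hm' _ (Rmin_r m m')) as [v' [hv' hl']].
rewrite (int_ab_unique _ _ _ _ _ hv' hv) in hl'.
apply Rabs_def2 in hl; apply Rabs_def2 in hl'; apply Rabs_def1; lra.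
Qed.

Lemma sqrt_2PI_pos : 0 < sqrt (2 * PI).
Proof. apply sqrt_lt_R0; pose proof PI_RGT_0; lra. Qed.

(** The integral of [phi] from b to x is a difference of values of [gauss_int]; as that function is
    odd, its value at b tends to - [gauss_half] when b goes to minus infinity. *)
Lemma Phi_eq (x : R) : Phi x = (gauss_half + gauss_int x) / sqrt (2 * PI).
Proof.
pose proof sqrt_2PI_pos as hs.
apply Int_from_minf_eq; intros e he.
destruct (gauss_int_cv (e * sqrt (2 * PI))) as [m hm]; [nra|].
exists (- m); intros b hb.
exists ((gauss_int x - gauss_int b) / sqrt (2 * PI)); split.
- apply is_RInt_int_ab.
  replace ((gauss_int x - gauss_int b) / sqrt (2 * PI))
    with (minus (gauss_int x / sqrt (2 * PI)) (gauss_int b / sqrt (2 * PI)))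
    by (unfold minus, plus, opp; simpl; field; lra).
  apply (is_RInt_derive (fun x => gauss_int x / sqrt (2 * PI)) phi).
  + intros y _; unfold Rdiv at 1.
    apply (is_derive_ext (fun x => / sqrt (2 * PI) * gauss_int x));
      [intros; apply Rmult_comm|].
    replace (phi y) with (/ sqrt (2 * PI) * gauss y)
      by (unfold phi, gauss; field; lra).
    apply (is_derive_scal gauss_int), is_derive_gauss_int.
  + intros y _; apply (ex_derive_continuous phi); unfold phi; auto_derive; lra.
- specialize (hm (- b) ltac:(lra)); rewrite gauss_int_opp in hm.
  pose proof (gauss_int_le_half (- b)) as hG; rewrite gauss_int_opp in hG.
  replace (_ - _) with (- (gauss_half + gauss_int b) / sqrt (2 * PI)) by (field; lra).
  unfold Rdiv; rewrite Rabs_mult, (Rabs_pos_eq (/ _)), Rabs_Ropp, Rabs_pos_eq;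
    [|lra|left; apply Rinv_0_lt_compat, hs].
  apply Rmult_lt_reg_r with (sqrt (2 * PI)); [lra|].
  rewrite Rmult_assoc, Rinv_l by lra; lra.
Qed.

Lemma Phi_div_phi (a : R) : Phi a / phi a = mills a.
Proof.
rewrite Phi_eq; unfold phi, mills.
replace (a ^ 2 / 2) with (- (- a ^ 2 / 2)) by field; rewrite exp_Ropp.
pose proof sqrt_2PI_pos; pose proof (exp_pos (- a ^ 2 / 2)); field; lra.
Qed.

(** * The Gaussian substitution *)

(** The substitution variable x for n = 1 without its sign. It behaves like |u - 1| near 1, so it
    has a corner there. *)
Definition zeta (u : R) : R := sqrt (2 * (u - 1 - ln u)).

Lemma zeta_sqr (u : R) : 0 < u -> zeta u * zeta u = 2 * (u - 1 - ln u).
Proof. intros hu; apply sqrt_sqrt; pose proof (sub_ln_nonneg u hu); lra. Qed.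

Lemma zeta_1 : zeta 1 = 0.
Proof.
unfold zeta; rewrite ln_1; replace (2 * (1 - 1 - 0)) with 0 by ring; apply sqrt_0.
Qed.

Lemma zeta_lower (u : R) : 0 < u -> 3 * Rabs (u - 1) / (u + 2) <= zeta u.
Proof.
intros hu; apply Rsqr_incr_0_var; [|apply sqrt_pos].
unfold Rsqr; rewrite zeta_sqr by auto.
eapply Rle_trans; [|apply sub_ln_lower, hu].
right; replace ((u - 1) ^ 2) with (Rabs (u - 1) ^ 2) by apply pow2_abs.
field; lra.
Qed.

Lemma zeta_pos (u : R) : 0 < u -> u <> 1 -> 0 < zeta u.
Proof.
intros hu h1; eapply Rlt_le_trans; [|apply zeta_lower, hu].
apply Rdiv_lt_0_compat; [|lra].
assert (0 < Rabs (u - 1)) by (apply Rabs_pos_lt; lra); lra.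
Qed.

(** Both upper bounds on 2 (u - 1 - ln u) are at most (u - 1)^2 / r. In use, r is lam / n, the value
    of u at t = 0. *)
Lemma zeta_upper (r u : R) :
  0 < r <= 1 -> r <= u -> zeta u <= Rabs (u - 1) / sqrt r.
Proof.
intros hr hu; pose proof (sqrt_lt_R0 r (proj1 hr)).
pose proof (sqrt_sqrt r ltac:(lra)) as hs.
apply Rsqr_incr_0_var;
  [|apply Rle_mult_inv_pos; [apply Rabs_pos | auto]].
unfold Rsqr; rewrite zeta_sqr by lra.
replace (Rabs (u - 1) / sqrt r * (Rabs (u - 1) / sqrt r)) with ((u - 1) ^ 2 / r).
2:{ rewrite <- (pow2_abs (u - 1)), <- hs at 1; field; lra. }
pose proof (pow2_ge_0 (u - 1)).
destruct (Rle_dec 1 u) as [h | h].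
- eapply Rle_trans; [apply sub_ln_upper_ge1, h|].
  apply Rmult_le_reg_r with r; [lra|].
  unfold Rdiv; rewrite Rmult_assoc, Rinv_l by lra; nra.
- eapply Rle_trans; [apply sub_ln_upper_le1; lra|].
  apply Rmult_le_compat_l; [auto|]; apply Rinv_le_contravar; lra.
Qed.

(** Differentiating zeta^2 = 2 (u - 1 - ln u) gives zeta zeta' = 1 - 1/u. *)
Lemma is_derive_zeta (u : R) :
  0 < u -> u <> 1 -> is_derive zeta u ((u - 1) / (u * zeta u)).
Proof.
intros hu h1; pose proof (zeta_pos u hu h1) as hz.
pose proof (zeta_sqr u hu); unfold zeta in *; auto_derive.
- split; auto; split; auto; unfold Rminus in *; nra.
- unfold Rminus in *; field; lra.
Qed.

Lemma continuous_zeta (u : R) : 0 < u -> continuous zeta u.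
Proof.
intros hu; unfold zeta.
apply (continuous_comp (fun u => 2 * (u - 1 - ln u)) sqrt).
- apply (ex_derive_continuous (fun u => 2 * (u - 1 - ln u))); auto_derive; auto.
- apply continuous_sqrt.
Qed.

(** * The Erlang kernel in the Gaussian variable *)

Definition erl_ker (n lam t : R) : R := exp (- lam * t) * Rpower (1 + t) (n - 1).
Definition erl_u (n lam t : R) : R := lam * (1 + t) / n.
Definition erl_q (n lam t : R) : R :=
  n * (erl_u n lam t - 1 - ln (erl_u n lam t)).
Definition erl_x (n lam t : R) : R := sqrt n * zeta (erl_u n lam t).
Definition erl_J (n lam b : R) : R := RInt (erl_ker n lam) 0 b.

Lemma erl_u_pos (n lam t : R) : 0 < n -> 0 < lam -> -1 < t -> 0 < erl_u n lam t.
Proof.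
intros hn hl ht; apply Rdiv_lt_0_compat; auto; apply Rmult_lt_0_compat; lra.
Qed.

Lemma erl_q_eq (n lam t : R) : 0 < n -> 0 < lam -> -1 < t ->
  erl_q n lam t = erl_q n lam 0 + lam * t - n * ln (1 + t).
Proof.
intros hn hl ht; unfold erl_q, erl_u.
replace (lam * (1 + t) / n) with (lam / n * (1 + t)) by (field; lra).
replace (lam * (1 + 0) / n) with (lam / n) by (field; lra).
rewrite ln_mult; [field; lra | apply Rdiv_lt_0_compat; auto | lra].
Qed.

Lemma erl_x_sqr (n lam t : R) : 0 < n -> 0 < lam -> -1 < t ->
  (erl_x n lam t) ^ 2 / 2 = erl_q n lam t.
Proof.
intros hn hl ht; unfold erl_x, erl_q.
pose proof (zeta_sqr _ (erl_u_pos n lam t hn hl ht)) as hz.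
pose proof (sqrt_sqrt n ltac:(lra)) as hs.
replace ((sqrt n * zeta (erl_u n lam t)) ^ 2)
  with ((sqrt n * sqrt n) * (zeta (erl_u n lam t) * zeta (erl_u n lam t))) by ring.
rewrite hs, hz; field.
Qed.

Lemma erl_x_nonneg (n lam t : R) : 0 <= erl_x n lam t.
Proof. apply Rmult_le_pos; apply sqrt_pos. Qed.

Lemma exp_erl_q (n lam t : R) : 0 < n -> 0 < lam -> -1 < t ->
  exp (- erl_q n lam t)
  = exp (- erl_q n lam 0) * (exp (- lam * t) * Rpower (1 + t) n).
Proof.
intros hn hl ht; rewrite (erl_q_eq n lam t) by auto; unfold Rpower.
rewrite <- !exp_plus; f_equal; ring.
Qed.

Lemma Rpower_minus_1 (x n : R) : 0 < x -> Rpower x (n - 1) = Rpower x n / x.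
Proof.
intros hx; unfold Rminus; rewrite Rpower_plus, (Rpower_Ropp _ 1), Rpower_1; auto.
Qed.

(** Up to the constant exp (- q(0)), the kernel is the Gaussian exp (- x^2 / 2) in x = [erl_x],
    divided by 1 + t. *)
Lemma erl_ker_eq (n lam t : R) : 0 < n -> 0 < lam -> -1 < t ->
  exp (- erl_q n lam 0) * erl_ker n lam t = exp (- erl_q n lam t) / (1 + t).
Proof.
intros hn hl ht; rewrite (exp_erl_q n lam t) by auto; unfold erl_ker.
rewrite Rpower_minus_1 by lra; unfold Rdiv; ring.
Qed.

Lemma erl_ker_pos (n lam t : R) : 0 < erl_ker n lam t.
Proof. apply Rmult_lt_0_compat; apply exp_pos. Qed.

Lemma continuous_erl_ker (n lam t : R) : -1 < t -> continuous (erl_ker n lam) t.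
Proof.
intros ht; apply (ex_derive_continuous (erl_ker n lam)).
unfold erl_ker, Rpower; auto_derive; repeat split; lra.
Qed.

Lemma is_derive_erl_J (n lam b : R) :
  -1 < b -> is_derive (erl_J n lam) b (erl_ker n lam b).
Proof.
intros hb; apply (is_derive_RInt (erl_ker n lam) (erl_J n lam) 0 b).
(* The radius b + 1 keeps y, and with it the whole interval between 0 and y, to the right of the
   singularity at -1. *)
- exists (mkposreal (b + 1) ltac:(lra)); intros y hy.
  unfold ball in hy; simpl in hy; unfold AbsRing_ball, abs, minus, plus, opp in hy;
    simpl in hy; apply Rabs_def2 in hy.
  apply (RInt_correct (erl_ker n lam)).
  apply (ex_RInt_continuous (V := R_CompleteNormedModule) (erl_ker n lam)).
  intros z hz; apply continuous_erl_ker.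
  unfold Rmin in hz; destruct Rle_dec; lra.
- apply continuous_erl_ker, hb.
Qed.

Lemma erl_J_le (n lam a b : R) : 0 <= a -> a <= b -> erl_J n lam a <= erl_J n lam b.
Proof.
intros ha hab.
apply (le_of_is_derive_nonneg (erl_J n lam) (erl_ker n lam)); auto.
- intros; apply is_derive_erl_J; lra.
- intros; left; apply erl_ker_pos.
Qed.

Lemma erl_J_0 (n lam : R) : erl_J n lam 0 = 0.
Proof. apply (RInt_point 0 (erl_ker n lam)). Qed.

(* Comparison functions for [erl_J]: their derivative is singular only where
   [erl_u = 1], that is at [t = n / lam - 1], so the two sides are treated separately,
   with [k] of opposite sign because [erl_x] is the unsigned square root. *)
Definition erl_V (k m n lam t : R) : R :=
  k * gauss_int (erl_x n lam t) + m * exp (- erl_q n lam t).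

(** The derivative is factored so that exp (- q(t)) / (1 + t), the rescaled kernel of [erl_ker_eq],
    splits off. Comparing [erl_V] with [erl_J] then amounts to comparing the remaining factor with
    1. *)
Lemma is_derive_erl_V (k m n lam t : R) :
  0 < n -> 0 < lam -> -1 < t -> erl_u n lam t <> 1 ->
  is_derive (erl_V k m n lam) t
    (exp (- erl_q n lam t) / (1 + t) * (erl_u n lam t - 1)
     * (k * sqrt n / zeta (erl_u n lam t) - m * n)).
Proof.
intros hn hl ht hu.
pose proof (erl_u_pos n lam t hn hl ht) as hu0.
pose proof (zeta_pos _ hu0 hu) as hz.
assert (hdu : is_derive (erl_u n lam) t (lam / n)).
{ unfold erl_u; auto_derive; [lra | field; lra]. }
assert (hg : gauss (erl_x n lam t) = exp (- erl_q n lam t)).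
{ unfold gauss; rewrite <- (erl_x_sqr n lam t) by auto; f_equal; field. }
assert (h1 : is_derive (fun t => k * gauss_int (erl_x n lam t)) t
  (k * (lam / n * ((erl_u n lam t - 1) / (erl_u n lam t * zeta (erl_u n lam t))) * sqrt n
   * exp (- erl_q n lam t)))).
{ apply (is_derive_scal (fun t => gauss_int (erl_x n lam t))).
  rewrite <- hg.
  apply (is_derive_comp gauss_int (erl_x n lam)).
  - apply is_derive_gauss_int.
  - unfold erl_x; rewrite Rmult_comm.
    apply (is_derive_scal (fun t => zeta (erl_u n lam t))).
    apply (is_derive_comp zeta (erl_u n lam)); [apply is_derive_zeta|]; auto. }
assert (hq : is_derive (erl_q n lam) t (n * (lam / n - lam / n / erl_u n lam t))).
{ unfold erl_q, erl_u in *; auto_derive; [exact hu0 | field; repeat split; lra]. }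
assert (h2 : is_derive (fun t => m * exp (- erl_q n lam t)) t
  (m * (- (n * (lam / n - lam / n / erl_u n lam t)) * exp (- erl_q n lam t)))).
{ auto_derive; [eexists; exact hq|].
  replace (Derive (fun x : R => erl_q n lam x) t)
    with (n * (lam / n - lam / n / erl_u n lam t))
    by (symmetry; apply is_derive_unique, hq).
  ring. }
pose proof (is_derive_plus _ _ _ _ _ h1 h2) as h; unfold plus in h; simpl in h.
replace (exp _ / _ * _ * _) with
  (k * (lam / n * ((erl_u n lam t - 1) / (erl_u n lam t * zeta (erl_u n lam t))) * sqrt n
   * exp (- erl_q n lam t))
  + m * (- (n * (lam / n - lam / n / erl_u n lam t)) * exp (- erl_q n lam t))).
{ exact h. }
(* The inner derivative lam / n of u is traded for u / (1 + t), which produces the denominator 1 + t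
   of the kernel. *)
assert (E : lam / n = erl_u n lam t / (1 + t)) by (unfold erl_u; field; lra).
rewrite E; field; repeat split; lra.
Qed.

Lemma continuous_erl_V (k m n lam t : R) :
  0 < n -> 0 < lam -> -1 < t -> continuous (erl_V k m n lam) t.
Proof.
intros hn hl ht; pose proof (erl_u_pos n lam t hn hl ht) as hu0.
assert (hu : continuous (erl_u n lam) t).
{ apply (ex_derive_continuous (erl_u n lam)); unfold erl_u; auto_derive; lra. }
unfold erl_V; apply (continuous_plus (fun t => k * gauss_int (erl_x n lam t))).
- apply (continuous_scal_r k (fun t => gauss_int (erl_x n lam t))).
  apply (continuous_comp (erl_x n lam) gauss_int); [|apply continuous_gauss_int].
  apply (continuous_scal_r (sqrt n) (fun t => zeta (erl_u n lam t))).
  apply (continuous_comp (erl_u n lam) zeta); [auto | apply continuous_zeta, hu0].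
- apply (ex_derive_continuous (fun t => m * exp (- erl_q n lam t))).
  unfold erl_q, erl_u in *; auto_derive; auto.
Qed.

Lemma continuous_erl_J (n lam b : R) : -1 < b -> continuous (erl_J n lam) b.
Proof.
intros hb; apply (ex_derive_continuous (erl_J n lam)).
eexists; apply is_derive_erl_J, hb.
Qed.

(** * Two-sided bounds on the truncated integral *)

Lemma erl_V_le_J (k m n lam a b : R) :
  0 < n -> 0 < lam -> 0 <= a <= b ->
  (forall t, a < t < b -> erl_u n lam t <> 1 /\
     (erl_u n lam t - 1) * (k * sqrt n / zeta (erl_u n lam t) - m * n) <= 1) ->
  erl_V k m n lam b - erl_V k m n lam a
  <= exp (- erl_q n lam 0) * (erl_J n lam b - erl_J n lam a).
Proof.
intros hn hl hab H.
pose (f := fun t => exp (- erl_q n lam 0) * erl_J n lam t - erl_V k m n lam t).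
enough (f a <= f b) by (unfold f in *; lra).
eapply (le_of_derive_nonneg f); [lra | | |].
- intros t ht; unfold f.
  apply (is_derive_minus (fun t => exp (- erl_q n lam 0) * erl_J n lam t)).
  + apply (is_derive_scal (erl_J n lam)), is_derive_erl_J; lra.
  + apply is_derive_erl_V; try lra; apply H, ht.
- intros t ht; unfold f.
  apply (continuous_minus (fun t => exp (- erl_q n lam 0) * erl_J n lam t)).
  + apply (continuous_scal_r (exp (- erl_q n lam 0)) (erl_J n lam)).
    apply continuous_erl_J; lra.
  + apply continuous_erl_V; lra.
- intros t ht; cbv beta; rewrite erl_ker_eq by lra.
  destruct (H t ht) as [_ h].
  assert (0 < exp (- erl_q n lam t) / (1 + t))
    by (apply Rdiv_lt_0_compat; [apply exp_pos | lra]).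
  unfold minus, plus, opp; simpl; rewrite Rmult_assoc; nra.
Qed.

Lemma erl_J_le_V (k m n lam a b : R) :
  0 < n -> 0 < lam -> 0 <= a <= b ->
  (forall t, a < t < b -> erl_u n lam t <> 1 /\
     1 <= (erl_u n lam t - 1) * (k * sqrt n / zeta (erl_u n lam t) - m * n)) ->
  exp (- erl_q n lam 0) * (erl_J n lam b - erl_J n lam a)
  <= erl_V k m n lam b - erl_V k m n lam a.
Proof.
intros hn hl hab H.
pose (f := fun t => erl_V k m n lam t - exp (- erl_q n lam 0) * erl_J n lam t).
enough (f a <= f b) by (unfold f in *; lra).
eapply (le_of_derive_nonneg f); [lra | | |].
- intros t ht; unfold f.
  apply (is_derive_minus (erl_V k m n lam)).
  + apply is_derive_erl_V; try lra; apply H, ht.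
  + apply (is_derive_scal (erl_J n lam)), is_derive_erl_J; lra.
- intros t ht; unfold f.
  apply (continuous_minus (erl_V k m n lam)).
  + apply continuous_erl_V; lra.
  + apply (continuous_scal_r (exp (- erl_q n lam 0)) (erl_J n lam)).
    apply continuous_erl_J; lra.
- intros t ht; cbv beta; rewrite erl_ker_eq by lra.
  destruct (H t ht) as [_ h].
  assert (0 < exp (- erl_q n lam t) / (1 + t))
    by (apply Rdiv_lt_0_compat; [apply exp_pos | lra]).
  unfold minus, plus, opp; simpl; rewrite Rmult_assoc; nra.
Qed.

Lemma erl_u_sub_1 (n lam t : R) : 0 < n -> 0 < lam ->
  erl_u n lam t - 1 = lam / n * (t - (n / lam - 1)).
Proof. intros; unfold erl_u; field; lra. Qed.

Lemma erl_crit_nonneg (n lam : R) : 0 < lam <= n -> 0 <= n / lam - 1.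
Proof.
intros h; assert (1 <= n / lam); [|lra].
apply Rmult_le_reg_r with lam; [lra|]; unfold Rdiv; rewrite Rmult_assoc, Rinv_l; lra.
Qed.

(** At the critical point u = 1, so x and q vanish. The value does not depend on k, so the estimates
    from the left and from the right cancel there when added. *)
Lemma erl_V_crit (k m n lam : R) : 0 < n -> 0 < lam ->
  erl_V k m n lam (n / lam - 1) = m.
Proof.
intros hn hl.
assert (E : erl_u n lam (n / lam - 1) = 1) by (unfold erl_u; field; lra).
unfold erl_V, erl_x, erl_q; rewrite E, zeta_1, Rmult_0_r, gauss_int_0, ln_1.
replace (- (n * (1 - 1 - 0))) with 0 by ring; rewrite exp_0; ring.
Qed.

Lemma sign_mul_eq_abs (s d : R) : s * s = 1 -> 0 < s * d -> s * d = Rabs d.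
Proof.
intros hs h.
assert (h0 : (s - 1) * (s + 1) = 0) by (ring_simplify; lra).
apply Rmult_integral in h0; destruct h0 as [h0 | h0].
- replace s with 1 in * by lra; rewrite Rabs_pos_eq; lra.
- replace s with (- 1) in * by lra; rewrite Rabs_left; lra.
Qed.

(** With k = -1 / sqrt n left of the critical point, k = 1 / sqrt n right of it and m = 1 / (3 n),
    the condition of [erl_V_le_J] reads |u - 1| / zeta <= 1 + (u - 1) / 3 = (u + 2) / 3, which is
    [zeta_lower]. The two pieces are added and the positive term m exp (- q(b)) is dropped. *)
Lemma erl_J_lower (n lam b : R) : 0 < lam <= n -> n / lam - 1 <= b ->
  (gauss_int (erl_x n lam 0) + gauss_int (erl_x n lam b)) / sqrt n
    - exp (- erl_q n lam 0) / (3 * n)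
  <= exp (- erl_q n lam 0) * erl_J n lam b.
Proof.
intros hn hb; pose proof (erl_crit_nonneg n lam hn) as h0.
pose proof (sqrt_lt_R0 n ltac:(lra)) as hs.
assert (hln : 0 < lam / n) by (apply Rdiv_lt_0_compat; lra).
pose proof (sqrt_sqrt n ltac:(lra)) as hss.
(* Here s is the sign of u - 1, so one computation serves both sides. *)
assert (key : forall s t, s * s = 1 -> 0 <= t ->
  0 < s * (erl_u n lam t - 1) -> erl_u n lam t <> 1 /\
  (erl_u n lam t - 1) * (s / sqrt n * sqrt n / zeta (erl_u n lam t) - / (3 * n) * n) <= 1).
{ intros s t ss ht hu; set (u := erl_u n lam t) in *.
  assert (hu0 : 0 < u) by (apply erl_u_pos; lra).
  assert (hu1 : u <> 1) by (intros ->; rewrite Rminus_diag, Rmult_0_r in hu; lra).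
  split; auto.
  pose proof (zeta_pos u hu0 hu1) as hz; pose proof (zeta_lower u hu0) as hz'.
  pose proof (sign_mul_eq_abs s (u - 1) ss hu) as ha.
  rewrite <- ha in hz'.
  replace ((u - 1) * (s / sqrt n * sqrt n / zeta u - / (3 * n) * n))
    with (s * (u - 1) / zeta u - (u - 1) / 3) by (field; lra).
  assert (s * (u - 1) / zeta u <= (u + 2) / 3); [|lra].
  apply Rmult_le_reg_r with (zeta u); auto.
  unfold Rdiv; rewrite Rmult_assoc, Rinv_l, Rmult_1_r by lra.
  apply Rmult_le_compat_r with (r := (u + 2) / 3) in hz'; [|lra].
  replace (3 * (s * (u - 1)) / (u + 2) * ((u + 2) / 3)) with (s * (u - 1)) in hz'
    by (field; lra).
  lra. }
assert (H1 := erl_V_le_J (-1 / sqrt n) (/ (3 * n)) n lam 0 (n / lam - 1)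
  ltac:(lra) ltac:(lra) ltac:(lra)).
assert (H2 := erl_V_le_J (1 / sqrt n) (/ (3 * n)) n lam (n / lam - 1) b
  ltac:(lra) ltac:(lra) ltac:(lra)).
specialize (H1 ltac:(intros t ht; apply key; [lra | lra |
  rewrite erl_u_sub_1 by lra; nra])).
specialize (H2 ltac:(intros t ht; apply key; [lra | lra |
  rewrite erl_u_sub_1 by lra; nra])).
rewrite erl_V_crit in H1, H2 by lra; rewrite erl_J_0 in H1.
unfold erl_V in H1, H2.
assert (0 <= / (3 * n) * exp (- erl_q n lam b)).
{ apply Rmult_le_pos; [left; apply Rinv_0_lt_compat; lra | left; apply exp_pos]. }
unfold Rdiv in *; lra.
Qed.

(** Now m = 0 and k is enlarged by 1 / sqrt (lam / n): the condition becomes zeta <= |u - 1| / sqrt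
    (lam / n), which is [zeta_upper], as u >= lam / n for t >= 0. *)
Lemma erl_J_upper (n lam b : R) : 0 < lam <= n -> n / lam - 1 <= b ->
  exp (- erl_q n lam 0) * erl_J n lam b
  <= (gauss_int (erl_x n lam 0) + gauss_int (erl_x n lam b))
     / (sqrt (lam / n) * sqrt n).
Proof.
intros hn hb; pose proof (erl_crit_nonneg n lam hn) as h0.
pose proof (sqrt_lt_R0 n ltac:(lra)) as hs.
assert (hln : 0 < lam / n) by (apply Rdiv_lt_0_compat; lra).
pose proof (sqrt_lt_R0 _ hln) as hr.
assert (hr1 : lam / n <= 1).
{ apply Rmult_le_reg_r with n; [lra|]; unfold Rdiv; rewrite Rmult_assoc, Rinv_l; lra. }
assert (key : forall s t, s * s = 1 -> 0 <= t ->
  0 < s * (erl_u n lam t - 1) -> erl_u n lam t <> 1 /\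
  1 <= (erl_u n lam t - 1)
    * (s / (sqrt (lam / n) * sqrt n) * sqrt n / zeta (erl_u n lam t) - 0 * n)).
{ intros s t ss ht hu; set (u := erl_u n lam t) in *.
  assert (hu0 : 0 < u) by (apply erl_u_pos; lra).
  assert (hu1 : u <> 1) by (intros ->; rewrite Rminus_diag, Rmult_0_r in hu; lra).
  split; auto.
  assert (hru : lam / n <= u).
  { unfold u, erl_u; apply Rmult_le_compat_r; [left; apply Rinv_0_lt_compat; lra | nra]. }
  pose proof (zeta_pos u hu0 hu1) as hz.
  pose proof (zeta_upper (lam / n) u ltac:(lra) hru) as hz'.
  pose proof (sign_mul_eq_abs s (u - 1) ss hu) as ha.
  rewrite <- ha in hz'.
  replace ((u - 1) * _) with (s * (u - 1) / sqrt (lam / n) / zeta u)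
    by (field; lra).
  apply Rmult_le_reg_r with (zeta u); auto.
  unfold Rdiv at 1; rewrite (Rmult_assoc _ (/ zeta u)), Rinv_l by lra; lra. }
assert (H1 := erl_J_le_V (-1 / (sqrt (lam / n) * sqrt n)) 0 n lam 0 (n / lam - 1)
  ltac:(lra) ltac:(lra) ltac:(lra)).
assert (H2 := erl_J_le_V (1 / (sqrt (lam / n) * sqrt n)) 0 n lam (n / lam - 1) b
  ltac:(lra) ltac:(lra) ltac:(lra)).
specialize (H1 ltac:(intros t ht; apply key; [lra | lra |
  rewrite erl_u_sub_1 by lra; nra])).
specialize (H2 ltac:(intros t ht; apply key; [lra | lra |
  rewrite erl_u_sub_1 by lra; nra])).
rewrite erl_V_crit in H1, H2 by lra; rewrite erl_J_0 in H1.
unfold erl_V in H1, H2.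
unfold Rdiv in *; lra.
Qed.

(** * The Erlang integral *)

Lemma erl_q_unbounded (n lam B : R) : 0 < n -> 0 < lam ->
  exists m, 0 <= m /\ forall b, m <= b -> B <= erl_q n lam b.
Proof.
intros hn hl.
(* The tangent bound ln v <= v - 1 at v = (1 + b) / k, for this k, lets n ln (1 + b) use up only
   half of the linear growth lam b; [C] collects the constants, so that q(b) >= lam b / 2 - C. *)
pose (k := 2 * n / lam).
assert (hk : 0 < k) by (apply Rdiv_lt_0_compat; lra).
pose (C := lam / 2 - n + n * ln k - erl_q n lam 0).
exists (Rmax 0 (2 * (B + C) / lam)); split; [apply Rmax_l|].
intros b hb; pose proof (Rle_trans _ _ _ (Rmax_l _ _) hb) as hb0.
pose proof (Rle_trans _ _ _ (Rmax_r _ _) hb) as hb1.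
rewrite erl_q_eq by lra.
pose proof (sub_ln_nonneg ((1 + b) / k) ltac:(apply Rdiv_lt_0_compat; lra)) as h.
rewrite ln_div in h by lra.
assert (hE : (1 + b) / k = lam * (1 + b) / (2 * n)) by (unfold k; field; lra).
apply Rmult_le_compat_l with (r := n) in h; [|lra].
replace (n * ((1 + b) / k - 1 - (ln (1 + b) - ln k)))
  with (lam * (1 + b) / 2 - n - n * ln (1 + b) + n * ln k) in h
  by (rewrite hE; field; lra).
apply Rmult_le_compat_l with (r := lam / 2) in hb1; [|lra].
replace (lam / 2 * (2 * (B + C) / lam)) with (B + C) in hb1 by (field; lra).
unfold C in hb1; lra.
Qed.

Lemma erl_x_unbounded (n lam B : R) : 0 < n -> 0 < lam ->
  exists m, 0 <= m /\ forall b, m <= b -> B <= erl_x n lam b.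
Proof.
intros hn hl; destruct (erl_q_unbounded n lam (B ^ 2 / 2) hn hl) as [m [hm H]].
exists m; split; auto; intros b hb.
specialize (H b hb); rewrite <- erl_x_sqr in H by lra.
pose proof (erl_x_nonneg n lam b).
apply Rnot_lt_le; intros hB; nra.
Qed.

Lemma exp_mul_Rpower_cv (n lam e : R) : 0 < n -> 0 < lam -> 0 < e ->
  exists m, 0 <= m /\ forall b, m <= b -> exp (- lam * b) * Rpower (1 + b) n < e.
Proof.
intros hn hl he.
destruct (erl_q_unbounded n lam (erl_q n lam 0 - ln e + 1) hn hl) as [m [hm H]].
exists m; split; auto; intros b hb; specialize (H b hb).
rewrite (erl_q_eq n lam b) in H by lra.
unfold Rpower; rewrite <- exp_plus.
apply Rlt_le_trans with (exp (ln e)); [apply exp_increasing; lra | rewrite exp_ln; lra].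
Qed.

Lemma exp_erl_q_mills (n lam : R) : 0 < n -> 0 < lam ->
  exp (- erl_q n lam 0) * mills (erl_x n lam 0)
  = gauss_half + gauss_int (erl_x n lam 0).
Proof.
intros hn hl; unfold mills; rewrite erl_x_sqr by lra.
rewrite <- Rmult_assoc, <- exp_plus, Rplus_opp_l, exp_0; ring.
Qed.

(** The limit j is the supremum of the increasing [erl_J], finite by [erl_J_upper]; by
    [exp_erl_q_mills], multiplying by exp (- q(0)) turns the Gaussian integrals of the finite bounds
    into [mills]. *)
Lemma erl_J_cv (n lam : R) : 0 < lam <= n ->
  exists j,
    (forall b, 0 <= b -> erl_J n lam b <= j) /\
    (forall e, 0 < e -> exists m, 0 <= m /\ forall b, m <= b -> j - e < erl_J n lam b) /\
    mills (erl_x n lam 0) / sqrt n - 1 / (3 * n) <= j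
      <= mills (erl_x n lam 0) / (sqrt (lam / n) * sqrt n).
Proof.
intros hn; pose proof (sqrt_lt_R0 n ltac:(lra)) as hs.
pose proof (sqrt_lt_R0 (lam / n) ltac:(apply Rdiv_lt_0_compat; lra)) as hr.
pose proof (exp_pos (- erl_q n lam 0)) as he.
pose proof (exp_erl_q_mills n lam ltac:(lra) ltac:(lra)) as hm.
pose proof (erl_crit_nonneg n lam hn) as ht.
set (E := exp (- erl_q n lam 0)) in *; set (M := mills _) in *.
assert (hup : forall b, 0 <= b -> erl_J n lam b <= M / (sqrt (lam / n) * sqrt n)).
(* The upper estimate holds only beyond the critical point, so b is first moved there by
   monotonicity. *)
{ intros b hb.
  pose proof (Rmax_l b (n / lam - 1)) as h1; pose proof (Rmax_r b (n / lam - 1)) as h2.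
  set (b' := Rmax _ _) in *.
  eapply Rle_trans; [apply (erl_J_le n lam b b'); auto|].
  apply Rmult_le_reg_l with E; auto.
  eapply Rle_trans; [apply (erl_J_upper n lam b' hn h2)|].
  replace (E * (M / (sqrt (lam / n) * sqrt n)))
    with (E * M / (sqrt (lam / n) * sqrt n)) by (field; lra).
  rewrite hm; apply Rmult_le_compat_r.
  - left; apply Rinv_0_lt_compat, Rmult_lt_0_compat; auto.
  - pose proof (gauss_int_le_half (erl_x n lam b')); lra. }
destruct (completeness (fun y => exists b, 0 <= b /\ y = erl_J n lam b)) as [j [hj1 hj2]].
- eexists; intros y [b [hb ->]]; apply hup, hb.
- exists (erl_J n lam 0), 0; split; [lra | reflexivity].
- assert (hJ : forall b, 0 <= b -> erl_J n lam b <= j)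
    by (intros b hb; apply hj1; exists b; auto).
  exists j; split; [exact hJ | split; [|split]].
  + intros e he'; apply NNPP; intros hN.
    enough (j <= j - e) by lra.
    apply hj2; intros y [b [hb ->]].
    apply Rnot_lt_le; intros hlt; apply hN; exists b; split; auto.
    intros b' hb'; pose proof (erl_J_le n lam b b' hb hb'); lra.
  (* The lower bound on j is solved for [gauss_half], so that it can be checked at points [erl_x] n
     lam b with b large. *)
  + enough (gauss_half <= E * (j + 1 / (3 * n)) * sqrt n - gauss_int (erl_x n lam 0)) as h.
    { assert (h1 : E * M <= E * ((j + 1 / (3 * n)) * sqrt n)) by lra.
      apply Rmult_le_reg_l in h1; auto.
      apply Rmult_le_compat_r with (r := / sqrt n) in h1;
        [|left; apply Rinv_0_lt_compat, hs].
      rewrite Rmult_assoc, Rinv_r in h1 by lra; unfold Rdiv in *; lra. }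
    apply gauss_half_le; intros y.
    destruct (erl_x_unbounded n lam y ltac:(lra) ltac:(lra)) as [m [hm0 H]].
    pose proof (Rmax_l m (n / lam - 1)) as h1; pose proof (Rmax_r m (n / lam - 1)) as h2.
    set (b := Rmax _ _) in *.
    exists (erl_x n lam b); split; [apply H, h1|].
    pose proof (erl_J_lower n lam b hn h2) as hl; fold E in hl.
    pose proof (Rmult_le_compat_l E _ _ ltac:(lra) (hJ b ltac:(lra))) as hl'.
    assert (hl2 : (gauss_int (erl_x n lam 0) + gauss_int (erl_x n lam b)) / sqrt n
       <= E * (j + 1 / (3 * n))).
    { replace (E * (j + 1 / (3 * n))) with (E * j + E / (3 * n)) by (field; lra); lra. }
    apply Rmult_le_compat_r with (r := sqrt n) in hl2; [|lra].
    unfold Rdiv at 1 in hl2; rewrite Rmult_assoc, Rinv_l in hl2 by lra; lra.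
  + apply hj2; intros y [b [hb ->]]; apply hup, hb.
Qed.

Definition erl_fun (n lam t : R) : R := t * exp (- lam * t) * Rpower (1 + t) (n - 1).
Definition erl_int (n lam : R) : R := Int_to_inf (erl_fun n lam) 0.

(* Integration by parts: [exp (- lam t) (1 + t)^n] has derivative
   [(n - lam - lam t) exp (- lam t) (1 + t)^(n - 1)]. *)
Lemma is_RInt_erl_fun (n lam b : R) : 0 < lam -> 0 <= b ->
  is_RInt (erl_fun n lam) 0 b
    ((1 - exp (- lam * b) * Rpower (1 + b) n + (n - lam) * erl_J n lam b) / lam).
Proof.
intros hl hb.
pose (F := fun b => / lam * ((n - lam) * erl_J n lam b
                       - exp (- lam * b) * Rpower (1 + b) n)).
replace (_ / lam) with (minus (F b) (F 0)).
2:{ unfold F, minus, plus, opp; simpl; rewrite erl_J_0; unfold Rpower.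
    rewrite Rplus_0_r, ln_1, !Rmult_0_r, exp_0; field; lra. }
apply (is_RInt_derive F).
- intros t; rewrite (Rmin_left 0 b hb), (Rmax_right 0 b hb); intros ht.
  unfold F.
  assert (hd : is_derive (fun t => exp (- lam * t) * Rpower (1 + t) n) t
    ((n - lam - lam * t) * erl_ker n lam t)).
  { unfold erl_ker; rewrite Rpower_minus_1 by lra.
    unfold Rpower; auto_derive; [lra | field; lra]. }
  replace (erl_fun n lam t) with
    (/ lam * ((n - lam) * erl_ker n lam t - (n - lam - lam * t) * erl_ker n lam t))
    by (unfold erl_fun, erl_ker; field; lra).
  apply (is_derive_scal (fun b => (n - lam) * erl_J n lam b
                       - exp (- lam * b) * Rpower (1 + b) n)).
  apply (is_derive_minus (fun b => (n - lam) * erl_J n lam b)); auto.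
  apply (is_derive_scal (erl_J n lam)), is_derive_erl_J; lra.
- intros t; rewrite (Rmin_left 0 b hb), (Rmax_right 0 b hb); intros ht.
  apply (ex_derive_continuous (erl_fun n lam)).
  unfold erl_fun, Rpower; auto_derive; repeat split; lra.
Qed.

(** Letting b grow in the integration by parts gives lam I = 1 + (n - lam) j, with I the integral
    and j the limit of [erl_J]. The first conjunct records that the improper integral converges to
    the value chosen by [epsilon]. *)
Lemma erl_int_spec (n lam : R) : 0 < lam <= n ->
  improper_int_to_inf (erl_fun n lam) 0 (erl_int n lam) /\
  1 + (n - lam) * (mills (erl_x n lam 0) / sqrt n - 1 / (3 * n)) <= lam * erl_int n lam
    <= 1 + (n - lam) * (mills (erl_x n lam 0) / (sqrt (lam / n) * sqrt n)).
Proof.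
intros hn; destruct (erl_J_cv n lam hn) as [j [hj [hcv hb]]].
assert (H : improper_int_to_inf (erl_fun n lam) 0 ((1 + (n - lam) * j) / lam)).
{ intros e he.
  assert (he1 : 0 < e * lam / 2) by nra.
  destruct (exp_mul_Rpower_cv n lam (e * lam / 2)) as [m [hm h1]]; try lra.
  (* Half of the tolerance e lam goes to the boundary term, half to the tail of J; the added 1 keeps
     the denominator positive when n = lam. *)
  assert (he2 : 0 < e * lam / 2 / (n - lam + 1)) by (apply Rdiv_lt_0_compat; lra).
  destruct (hcv _ he2) as [m' [hm' h2]].
  exists (Rmax m m'); intros b hb'.
  pose proof (Rmax_l m m'); pose proof (Rmax_r m m').
  eexists; split; [apply is_RInt_int_ab, is_RInt_erl_fun; lra|].
  specialize (h1 b ltac:(lra)); specialize (h2 b ltac:(lra)).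
  specialize (hj b ltac:(lra)).
  set (X := exp _ * _) in *; set (Y := erl_J n lam b) in *.
  assert (hX : 0 < X) by (apply Rmult_lt_0_compat; apply exp_pos).
  assert (hY : (n - lam) * (j - Y) <= e * lam / 2).
  { apply Rle_trans with ((n - lam + 1) * (e * lam / 2 / (n - lam + 1))).
    - apply Rmult_le_compat; lra.
    - right; field; lra. }
  assert (hY0 : 0 <= (n - lam) * (j - Y)) by (apply Rmult_le_pos; lra).
  replace (_ - _) with (- (X + (n - lam) * (j - Y)) / lam) by (field; lra).
  unfold Rdiv at 1; rewrite Rabs_mult, (Rabs_pos_eq (/ _)), Rabs_Ropp, Rabs_pos_eq;
    [|lra|left; apply Rinv_0_lt_compat; lra].
  apply Rmult_lt_reg_r with lam; [lra|].
  rewrite Rmult_assoc, Rinv_l by lra; lra. }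
assert (E : erl_int n lam = (1 + (n - lam) * j) / lam) by apply Int_to_inf_eq, H.
rewrite E; split; [exact H|].
replace (lam * ((1 + (n - lam) * j) / lam)) with (1 + (n - lam) * j) by (field; lra).
split; apply Rplus_le_compat_l, Rmult_le_compat_l; lra.
Qed.

(** * Convexity of the Erlang integral in n *)

Lemma int_ab_is_RInt (f : R -> R) (a b v : R) : int_ab f a b v -> is_RInt f a b v.
Proof.
intros [pr <-]; rewrite <- RInt_Reals; apply (RInt_correct f).
apply ex_RInt_Reals_1, pr.
Qed.

Lemma improper_int_convex_le (f g k : R -> R) (a h If Ig Ik : R) : 0 <= h <= 1 ->
  improper_int_to_inf f a If -> improper_int_to_inf g a Ig ->
  improper_int_to_inf k a Ik ->
  (forall t, a < t -> f t <= (1 - h) * g t + h * k t) ->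
  If <= (1 - h) * Ig + h * Ik.
Proof.
intros hh Hf Hg Hk H; apply le_epsilon; intros e he.
destruct (Hf (e / 2) ltac:(lra)) as [m1 h1].
destruct (Hg (e / 2) ltac:(lra)) as [m2 h2].
destruct (Hk (e / 2) ltac:(lra)) as [m3 h3].
pose proof (Rmax_l (Rmax a m1) (Rmax m2 m3)); pose proof (Rmax_r (Rmax a m1) (Rmax m2 m3)).
pose proof (Rmax_l a m1); pose proof (Rmax_r a m1).
pose proof (Rmax_l m2 m3); pose proof (Rmax_r m2 m3).
set (b := Rmax (Rmax a m1) (Rmax m2 m3)) in *.
destruct (h1 b ltac:(lra)) as [v1 [i1 e1]].
destruct (h2 b ltac:(lra)) as [v2 [i2 e2]].
destruct (h3 b ltac:(lra)) as [v3 [i3 e3]].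
apply int_ab_is_RInt in i1, i2, i3.
assert (hv : v1 <= (1 - h) * v2 + h * v3).
{ apply (is_RInt_le f (fun t => (1 - h) * g t + h * k t) a b); auto; [lra| |].
  - apply (is_RInt_plus (fun t => (1 - h) * g t) (fun t => h * k t));
      [apply (is_RInt_scal g) | apply (is_RInt_scal k)]; auto.
  - intros t ht; apply H; lra. }
apply Rabs_def2 in e1; apply Rabs_def2 in e2; apply Rabs_def2 in e3.
assert ((1 - h) * v2 <= (1 - h) * (Ig + e / 2)) by (apply Rmult_le_compat_l; lra).
assert (h * v3 <= h * (Ik + e / 2)) by (apply Rmult_le_compat_l; lra).
lra.
Qed.

(** The tangent line at the weighted mean m lies below exp, and averaging it over p and q gives
    exactly exp m. *)
Lemma exp_convex (p q h : R) : 0 <= h <= 1 ->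
  exp ((1 - h) * p + h * q) <= (1 - h) * exp p + h * exp q.
Proof.
intros hh; set (m := (1 - h) * p + h * q).
assert (tg : forall x, exp m * (1 + (x - m)) <= exp x).
{ intros x; replace (exp x) with (exp m * exp (x - m)) by (rewrite <- exp_plus; f_equal; ring).
  apply Rmult_le_compat_l; [left; apply exp_pos | apply exp_ineq1_le]. }
pose proof (Rmult_le_compat_l (1 - h) _ _ ltac:(lra) (tg p)) as h1.
pose proof (Rmult_le_compat_l h _ _ ltac:(lra) (tg q)) as h2.
enough (E : (1 - h) * (exp m * (1 + (p - m))) + h * (exp m * (1 + (q - m))) = exp m) by lra.
replace (_ + _) with (exp m * (1 + ((1 - h) * p + h * q - m))) by ring.
fold m; ring.
Qed.

(** The integrand is a nonnegative weight times the exponential of an affine function of n.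
    Convexity supplies the control to the right of b used in [least_alpha_tilde_exists]. *)
Lemma erl_int_convex (n0 n1 lam h : R) :
  0 < lam <= n0 -> lam <= n1 -> 0 <= h <= 1 ->
  erl_int ((1 - h) * n0 + h * n1) lam <= (1 - h) * erl_int n0 lam + h * erl_int n1 lam.
Proof.
intros h0 h1 hh.
apply (improper_int_convex_le (erl_fun ((1 - h) * n0 + h * n1) lam)
  (erl_fun n0 lam) (erl_fun n1 lam) 0); auto.
- apply erl_int_spec; nra.
- apply erl_int_spec; lra.
- apply erl_int_spec; lra.
- intros t ht; unfold erl_fun, Rpower.
  replace (((1 - h) * n0 + h * n1 - 1) * ln (1 + t))
    with ((1 - h) * ((n0 - 1) * ln (1 + t)) + h * ((n1 - 1) * ln (1 + t))) by ring.
  pose proof (exp_convex ((n0 - 1) * ln (1 + t)) ((n1 - 1) * ln (1 + t)) h hh) as hc.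
  apply Rmult_le_compat_l with (r := t * exp (- lam * t)) in hc; [lra|].
  apply Rmult_le_pos; [lra | left; apply exp_pos].
Qed.

(** * The two optimization problems *)

(** The reciprocal of [UB], with gamma written as b sqrt (lam / n), Phi / phi as [mills], and 2
    gamma / (3 sqrt n) as 2/3 (1 - lam / n). *)
Definition UB_inv (b lam : R) : R :=
  let n := lam + b * sqrt lam in
  lam / n + b * sqrt (lam / n) * mills (erl_x n lam 0) + 2 / 3 * (1 - lam / n).

Lemma staffing_ge (b lam : R) : 0 < lam -> 0 <= b -> lam <= lam + b * sqrt lam.
Proof.
intros hl hb; pose proof (sqrt_pos lam); pose proof (Rmult_le_pos b (sqrt lam)); lra.
Qed.

Lemma ratio_bounds (n lam : R) : 0 < lam <= n -> 0 < lam / n <= 1.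
Proof.
intros h; split; [apply Rdiv_lt_0_compat; lra|].
apply Rmult_le_reg_r with n; [lra|]; unfold Rdiv; rewrite Rmult_assoc, Rinv_l; lra.
Qed.

Lemma ratio_eq (b lam : R) : 0 < lam -> 0 <= b ->
  lam / (lam + b * sqrt lam) = sqrt lam / (sqrt lam + b).
Proof.
intros hl hb; pose proof (sqrt_lt_R0 lam hl); pose proof (sqrt_sqrt lam ltac:(lra)) as hs.
transitivity ((sqrt lam * sqrt lam) / (sqrt lam * sqrt lam + b * sqrt lam)).
- now rewrite hs.
- field; split; nra.
Qed.

Lemma gamma_eq (b lam : R) : 0 < lam -> 0 <= b ->
  let n := lam + b * sqrt lam in (n - lam) / sqrt n = b * sqrt (lam / n).
Proof.
intros hl hb n; pose proof (staffing_ge b lam hl hb) as hn; fold n in hn.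
pose proof (sqrt_lt_R0 n ltac:(lra)).
rewrite sqrt_div_alt by lra.
replace (n - lam) with (b * sqrt lam) by (unfold n; ring).
unfold Rdiv; ring.
Qed.

Lemma erl_x_0_eq (n lam : R) : 0 < lam <= n ->
  sqrt (- 2 * n * (1 - lam / n + ln (lam / n))) = erl_x n lam 0.
Proof.
intros h; unfold erl_x, zeta, erl_u; rewrite <- sqrt_mult_alt by lra.
replace (lam * (1 + 0) / n) with (lam / n) by (field; lra).
f_equal; ring.
Qed.

Lemma one_sub_ratio (b lam : R) : 0 < lam -> 0 <= b ->
  let n := lam + b * sqrt lam in
  sqrt n * Rabs (erl_u n lam 0 - 1) = b * sqrt (lam / n).
Proof.
intros hl hb n; pose proof (gamma_eq b lam hl hb) as hg; cbv zeta in hg; fold n in hg.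
rewrite <- hg.
pose proof (staffing_ge b lam hl hb) as hn; fold n in hn.
pose proof (sqrt_lt_R0 n ltac:(lra)) as hs; pose proof (sqrt_sqrt n ltac:(lra)) as hss.
replace (erl_u n lam 0 - 1) with (- ((n - lam) / n)) by (unfold erl_u; field; lra).
rewrite Rabs_Ropp, Rabs_pos_eq by (apply Rle_mult_inv_pos; lra).
rewrite <- hss at 3; field; lra.
Qed.

(** Here [erl_x] at t = 0 is the quantity a of [UB]. The bounds are [zeta_lower] and [zeta_upper] at
    u = lam / n, with u + 2 <= 3 in the first and r = u in the second; they squeeze a towards b as
    lam grows. *)
Lemma erl_x_0_bounds (b lam : R) : 0 < lam -> 0 <= b ->
  let n := lam + b * sqrt lam in
  b * sqrt (lam / n) <= erl_x n lam 0 <= b.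
Proof.
intros hl hb n; pose proof (staffing_ge b lam hl hb) as hn; fold n in hn.
pose proof (sqrt_lt_R0 n ltac:(lra)) as hs.
pose proof (ratio_bounds n lam ltac:(lra)) as hr.
pose proof (sqrt_lt_R0 _ (proj1 hr)) as hrs.
assert (hu : erl_u n lam 0 = lam / n) by (unfold erl_u; field; lra).
pose proof (one_sub_ratio b lam hl hb) as hd; cbv zeta in hd; fold n in hd.
split; [rewrite <- hd|].
- apply Rmult_le_compat_l; [lra|].
  eapply Rle_trans; [|apply zeta_lower; lra].
  apply Rmult_le_reg_r with (erl_u n lam 0 + 2); [lra|].
  unfold Rdiv; rewrite Rmult_assoc, Rinv_l by lra.
  pose proof (Rabs_pos (erl_u n lam 0 - 1)); nra.
- apply Rle_trans with (sqrt n * (Rabs (erl_u n lam 0 - 1) / sqrt (lam / n))).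
  + apply Rmult_le_compat_l; [lra|]; apply zeta_upper; lra.
  + right; unfold Rdiv at 1; rewrite <- Rmult_assoc, hd; field; lra.
Qed.

Lemma UB_eq (b lam : R) : 0 < lam -> 0 <= b -> UB b lam = / UB_inv b lam.
Proof.
intros hl hb; pose proof (staffing_ge b lam hl hb) as hn.
unfold UB, UB_inv; cbv zeta.
rewrite erl_x_0_eq, Phi_div_phi by lra.
pose proof (gamma_eq b lam hl hb) as hg; cbv zeta in hg; rewrite <- hg.
set (n := lam + b * sqrt lam) in *; f_equal.
pose proof (sqrt_lt_R0 n ltac:(lra)) as hs; pose proof (sqrt_sqrt n ltac:(lra)) as hss.
replace (1 - lam / n) with ((n - lam) / (sqrt n * sqrt n)) by (rewrite hss; field; lra).
field; lra.
Qed.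

(** The reciprocal of the Halfin-Whitt delay probability, the limit H of the bounds. *)
Definition halfin_whitt (b : R) : R := 1 + b * mills b.

(** On the left, 1 - (1 - rho) / 3 = rho + 2/3 (1 - rho) makes the lower bound of [erl_int_spec]
    equal to [UB_inv]. On the right, the factor 1 / sqrt rho turns gamma into b, and a <= b
    finishes. *)
Lemma erl_int_bounds (b lam : R) : 0 < lam -> 0 <= b ->
  UB_inv b lam <= lam * erl_int (lam + b * sqrt lam) lam <= halfin_whitt b.
Proof.
intros hl hb; pose proof (staffing_ge b lam hl hb) as hn.
pose proof (erl_x_0_bounds b lam hl hb) as hx; cbv zeta in hx.
pose proof (gamma_eq b lam hl hb) as hg; cbv zeta in hg.
unfold UB_inv, halfin_whitt; cbv zeta; rewrite <- hg.
set (n := lam + b * sqrt lam) in *.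
pose proof (sqrt_lt_R0 n ltac:(lra)) as hs.
pose proof (ratio_bounds n lam ltac:(lra)) as hr.
pose proof (sqrt_lt_R0 _ (proj1 hr)) as hrs.
destruct (erl_int_spec n lam ltac:(lra)) as [_ [h1 h2]].
split.
- eapply Rle_trans; [|exact h1]; right; field; lra.
- eapply Rle_trans; [exact h2|]; apply Rplus_le_compat_l.
  apply Rle_trans with (b * mills (erl_x n lam 0)).
  + right; transitivity ((n - lam) / sqrt n / sqrt (lam / n) * mills (erl_x n lam 0)).
    * field; lra.
    * rewrite hg; field; lra.
  + apply Rmult_le_compat_l; auto; apply mills_le; [apply erl_x_nonneg | lra].
Qed.

Lemma UB_inv_pos (b lam : R) : 0 < lam -> 0 <= b -> 0 < UB_inv b lam.
Proof.
intros hl hb; pose proof (staffing_ge b lam hl hb) as hn.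
unfold UB_inv; cbv zeta; set (n := lam + b * sqrt lam) in *.
pose proof (ratio_bounds n lam ltac:(lra)) as hr.
pose proof gauss_half_pos.
pose proof (mills_ge_half _ (erl_x_nonneg n lam 0)).
assert (0 <= b * sqrt (lam / n) * mills (erl_x n lam 0)).
{ apply Rmult_le_pos; [apply Rmult_le_pos; [lra | apply sqrt_pos] | lra]. }
lra.
Qed.

Lemma inv_le_swap (x e : R) : 0 < x -> 0 < e -> / x <= e <-> / e <= x.
Proof.
intros hx he; split; intros h; [rewrite <- (Rinv_inv x) | rewrite <- (Rinv_inv e)];
  apply Rinv_le_contravar; auto; apply Rinv_0_lt_compat; auto.
Qed.

Lemma UB_le_iff (b lam eps : R) : 0 < lam -> 0 <= b -> 0 < eps ->
  UB b lam <= eps <-> / eps <= UB_inv b lam.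
Proof.
intros hl hb he; rewrite UB_eq by auto; apply inv_le_swap; auto.
apply UB_inv_pos; auto.
Qed.

(** As eps < 1, the minimum with 1 is at most eps exactly when its other argument is. *)
Lemma alpha_tilde_le_iff (b lam eps : R) : 0 < lam -> 0 <= b -> 0 < eps < 1 ->
  alpha_tilde b lam <= eps <-> / eps <= lam * erl_int (lam + b * sqrt lam) lam.
Proof.
intros hl hb he.
change (alpha_tilde b lam) with (Rmin 1 (/ (lam * erl_int (lam + b * sqrt lam) lam))).
pose proof (erl_int_bounds b lam hl hb); pose proof (UB_inv_pos b lam hl hb).
rewrite <- inv_le_swap by lra.
unfold Rmin; destruct Rle_dec; lra.
Qed.

Lemma continuous_UB_inv (b lam : R) : 0 < lam -> 0 <= b ->
  continuous (fun b => UB_inv b lam) b.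
Proof.
intros hl hb; pose proof (staffing_ge b lam hl hb) as hn.
assert (hr : continuous (fun b => lam / (lam + b * sqrt lam)) b).
{ apply (ex_derive_continuous (fun b => lam / (lam + b * sqrt lam))); auto_derive; lra. }
unfold UB_inv; cbv zeta.
apply (continuous_plus (fun b => lam / (lam + b * sqrt lam)
  + b * sqrt (lam / (lam + b * sqrt lam)) * mills (erl_x (lam + b * sqrt lam) lam 0))).
- apply (continuous_plus (fun b => lam / (lam + b * sqrt lam))); auto.
  apply (continuous_mult (fun b => b * sqrt (lam / (lam + b * sqrt lam)))).
  + apply (continuous_mult (fun b : R => b) (fun b => sqrt (lam / (lam + b * sqrt lam))));
      [apply continuous_id|].
    apply (continuous_comp _ sqrt); [exact hr | apply continuous_sqrt].
  + apply (continuous_comp (fun b => erl_x (lam + b * sqrt lam) lam 0) mills);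
      [|apply continuous_mills].
    unfold erl_x; apply (continuous_mult (fun b => sqrt (lam + b * sqrt lam))).
    * apply (continuous_comp (fun b => lam + b * sqrt lam) sqrt); [|apply continuous_sqrt].
      apply (ex_derive_continuous (fun b => lam + b * sqrt lam)); auto_derive; auto.
    * apply (continuous_comp (fun b => erl_u (lam + b * sqrt lam) lam 0) zeta).
      -- apply (ex_derive_continuous (fun b => erl_u (lam + b * sqrt lam) lam 0)).
         unfold erl_u; auto_derive; lra.
      -- apply continuous_zeta, erl_u_pos; lra.
- apply (continuous_scal_r (2 / 3) (fun b => 1 - lam / (lam + b * sqrt lam))).
  apply (continuous_minus (fun _ => 1)); [apply continuous_const | exact hr].
Qed.

Lemma UB_inv_unbounded (lam K : R) : 0 < lam -> 0 < K ->
  exists b, 0 <= b /\ K <= UB_inv b lam.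
Proof.
intros hl hK; pose proof gauss_half_pos as hG.
pose proof (sqrt_lt_R0 lam hl) as hs; pose proof (sqrt_sqrt lam ltac:(lra)) as hss.
pose (Y := K / gauss_half).
assert (hY : 0 < Y) by (apply Rdiv_lt_0_compat; lra).
(* Since b >= sqrt lam, gamma^2 = b^2 sqrt lam / (sqrt lam + b) is at least b sqrt lam / 2, and the
   second summand makes this at least Y^2. Then gamma times [mills] is at least Y times
   [gauss_half], which is K. *)
pose (b := sqrt lam + 2 * (Y * Y) / sqrt lam).
assert (hb : sqrt lam <= b).
{ assert (0 <= 2 * (Y * Y) / sqrt lam) by (apply Rle_mult_inv_pos; nra).
  unfold b; lra. }
exists b; split; [lra|].
pose proof (staffing_ge b lam hl ltac:(lra)) as hn.
unfold UB_inv; cbv zeta; set (n := lam + b * sqrt lam) in *.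
pose proof (ratio_bounds n lam ltac:(lra)) as hr.
pose proof (mills_ge_half _ (erl_x_nonneg n lam 0)) as hm.
assert (hY2 : Y <= b * sqrt (lam / n)).
{ pose proof (sqrt_lt_R0 _ (proj1 hr)) as hrs.
  pose proof (sqrt_sqrt (lam / n) ltac:(lra)) as hrss.
  apply Rsqr_incr_0_var; [|nra]; unfold Rsqr.
  replace (b * sqrt (lam / n) * (b * sqrt (lam / n))) with (b * b * (sqrt (lam / n) * sqrt (lam / n))) by ring.
  rewrite hrss.
  unfold n; rewrite ratio_eq by lra.
  apply Rmult_le_reg_r with (sqrt lam + b); [lra|].
  replace (b * b * (sqrt lam / (sqrt lam + b)) * (sqrt lam + b))
    with (b * (b * sqrt lam)) by (field; lra).
  replace (b * sqrt lam) with (sqrt lam * sqrt lam + 2 * (Y * Y))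
    by (unfold b; field; lra).
  rewrite hss.
  nra. }
assert (K <= b * sqrt (lam / n) * mills (erl_x n lam 0)); [|lra].
replace K with (Y * gauss_half) by (unfold Y; field; lra).
apply Rmult_le_compat; lra.
Qed.

(** * Existence of least feasible points *)

(** The infimum m, built as the supremum of the lower bounds, lies in S: otherwise S would miss some
    [m, m + d), and m + d would be a larger lower bound. *)
Lemma least_exists (S : R -> Prop) :
  (exists b, 0 <= b /\ S b) ->
  (forall b, 0 <= b -> ~ S b ->
     exists d, 0 < d /\ forall h, 0 <= h < d -> ~ S (b + h)) ->
  exists m, 0 <= m /\ S m /\ forall b, 0 <= b -> S b -> m <= b.
Proof.
intros [b0 [hb0 hS0]] H.
destruct (completeness (fun x => forall b, 0 <= b -> S b -> x <= b)) as [m [h1 h2]].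
- exists b0; intros x hx; apply hx; auto.
- exists 0; auto.
- assert (hm : 0 <= m) by (apply h1; auto).
  assert (hlow : forall b, 0 <= b -> S b -> m <= b)
    by (intros b hb hS; apply h2; intros x hx; auto).
  exists m; split; auto; split; auto.
  apply NNPP; intros hN; destruct (H m hm hN) as [d [hd hd']].
  enough (m + d <= m) by lra.
  apply h1; intros b hb hS; apply Rnot_lt_le; intros hlt.
  pose proof (hlow b hb hS).
  apply (hd' (b - m) ltac:(lra)); replace (m + (b - m)) with b by ring; auto.
Qed.

Lemma least_UB_exists (lam eps : R) : 0 < lam -> 0 < eps ->
  exists m, 0 <= m /\ UB m lam <= eps /\ forall b, 0 <= b -> UB b lam <= eps -> m <= b.
Proof.
intros hl he; apply (least_exists (fun b => UB b lam <= eps)).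
- destruct (UB_inv_unbounded lam (/ eps) hl (Rinv_0_lt_compat _ he)) as [b [hb h]].
  exists b; split; auto; apply UB_le_iff; auto.
- intros b hb hN; rewrite UB_le_iff in hN by auto; apply Rnot_le_lt in hN.
  pose proof (continuous_UB_inv b lam hl hb) as hc.
  apply continuity_pt_filterlim in hc.
  pose proof (proj1 (continuity_pt_locally (fun b => UB_inv b lam) b) hc) as hc'.
  destruct (hc' (mkposreal (/ eps - UB_inv b lam) ltac:(lra))) as [d hd]; simpl in hd.
  exists d; split; [apply cond_pos|]; intros h hh.
  rewrite UB_le_iff by (auto; lra); apply Rlt_not_le.
  specialize (hd (b + h)).
  assert (hball : ball b d (b + h)).
  { unfold ball; simpl; unfold AbsRing_ball, abs, minus, plus, opp; simpl.
    apply Rabs_def1; lra. }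
  specialize (hd hball); apply Rabs_def2 in hd; lra.
Qed.

Lemma alpha_tilde_le_of_UB_le (b lam eps : R) : 0 < lam -> 0 <= b -> 0 < eps < 1 ->
  UB b lam <= eps -> alpha_tilde b lam <= eps.
Proof.
intros hl hb he h; apply alpha_tilde_le_iff; auto.
apply UB_le_iff in h; try lra; pose proof (erl_int_bounds b lam hl hb); lra.
Qed.

Lemma least_alpha_tilde_exists (lam eps : R) : 0 < lam -> 0 < eps < 1 ->
  exists m, 0 <= m /\ alpha_tilde m lam <= eps /\
    forall b, 0 <= b -> alpha_tilde b lam <= eps -> m <= b.
Proof.
intros hl he; apply (least_exists (fun b => alpha_tilde b lam <= eps)).
- destruct (least_UB_exists lam eps hl ltac:(lra)) as [b [hb [h _]]].
  exists b; split; auto; apply alpha_tilde_le_of_UB_le; auto.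
- intros b hb hN; rewrite alpha_tilde_le_iff in hN by auto; apply Rnot_le_lt in hN.
  set (v0 := lam * erl_int (lam + b * sqrt lam) lam) in *.
  pose (v1 := lam * erl_int (lam + (b + 1) * sqrt lam) lam).
  pose proof (Rabs_pos (v1 - v0)) as hpos; pose proof (Rle_abs (v1 - v0)).
  assert (hd0 : 0 < (/ eps - v0) / (1 + Rabs (v1 - v0))) by (apply Rdiv_lt_0_compat; lra).
  (* By convexity between b and b + 1, a step h <= 1 raises lam I by at most h |v1 - v0|, so this
     length keeps it below 1 / eps; the 1 in the denominator covers v1 = v0. *)
  exists (Rmin 1 ((/ eps - v0) / (1 + Rabs (v1 - v0)))); split.
  + apply Rmin_glb_lt; lra.
  + intros h [hh hd].
    pose proof (Rlt_le_trans _ _ _ hd (Rmin_l _ _)) as hd1.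
    pose proof (Rlt_le_trans _ _ _ hd (Rmin_r _ _)) as hd2.
    rewrite alpha_tilde_le_iff by lra; apply Rlt_not_le.
    apply Rmult_lt_compat_r with (r := 1 + Rabs (v1 - v0)) in hd2; [|lra].
    unfold Rdiv in hd2; rewrite Rmult_assoc, Rinv_l, Rmult_1_r in hd2 by lra.
    pose proof (erl_int_convex (lam + b * sqrt lam) (lam + (b + 1) * sqrt lam) lam h
      ltac:(split; [lra | apply staffing_ge; lra]) ltac:(apply staffing_ge; lra)
      ltac:(lra)) as hc.
    replace ((1 - h) * (lam + b * sqrt lam) + h * (lam + (b + 1) * sqrt lam))
      with (lam + (b + h) * sqrt lam) in hc by ring.
    apply Rmult_le_compat_l with (r := lam) in hc; [|lra].
    replace (lam * ((1 - h) * erl_int (lam + b * sqrt lam) lam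
      + h * erl_int (lam + (b + 1) * sqrt lam) lam)) with (v0 + h * (v1 - v0)) in hc
      by (unfold v0, v1; ring).
    assert (h * (v1 - v0) <= h * Rabs (v1 - v0)) by (apply Rmult_le_compat_l; lra).
    lra.
Qed.

(** * The limit function and the behaviour of [UB_inv] for large lam *)

Lemma halfin_whitt_lt (a b : R) : 0 <= a -> a < b -> halfin_whitt a < halfin_whitt b.
Proof.
intros ha hab; unfold halfin_whitt; pose proof gauss_half_pos.
pose proof (mills_ge_half a ha); pose proof (mills_le a b ha ltac:(lra)); nra.
Qed.

Lemma halfin_whitt_root (K : R) : 1 < K -> exists b, 0 <= b /\ halfin_whitt b = K.
Proof.
intros hK; pose proof gauss_half_pos as hG.
assert (hB : 0 < K / gauss_half) by (apply Rdiv_lt_0_compat; lra).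
(* At the right endpoint b = K / [gauss_half] the bound [mills] >= [gauss_half] gives b [mills] b >=
   K; at 0 the function is 1. *)
destruct (IVT_gen halfin_whitt 0 (K / gauss_half) K) as [b [hb h]].
- intros x; apply continuity_pt_filterlim; unfold halfin_whitt.
  apply (continuous_plus (fun _ => 1) (fun x => x * mills x)); [apply continuous_const|].
  apply (continuous_mult (fun x : R => x) mills); [apply continuous_id | apply continuous_mills].
- pose proof (mills_ge_half (K / gauss_half) ltac:(lra)) as hm.
  assert (h0 : halfin_whitt 0 = 1) by (unfold halfin_whitt; ring).
  assert (h1 : K <= halfin_whitt (K / gauss_half)).
  { unfold halfin_whitt; apply Rmult_le_compat_l with (r := K / gauss_half) in hm; [|lra].
    unfold Rdiv at 1 in hm; rewrite Rmult_assoc, Rinv_l in hm by lra; lra. }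
  rewrite h0; split; [eapply Rle_trans; [apply Rmin_l | lra]|].
  eapply Rle_trans; [exact h1 | apply Rmax_r].
- exists b; split; auto.
  rewrite Rmin_left in hb; lra.
Qed.

Lemma UB_inv_ge_halfin_whitt (b lam : R) : 0 < lam -> 0 <= b ->
  let r := lam / (lam + b * sqrt lam) in
  halfin_whitt (b * sqrt r) - (1 - r) <= UB_inv b lam.
Proof.
intros hl hb r; pose proof (staffing_ge b lam hl hb) as hn.
pose proof (ratio_bounds _ lam (conj hl hn)) as hr; fold r in hr.
pose proof (erl_x_0_bounds b lam hl hb) as hx; cbv zeta in hx; fold r in hx.
pose proof (sqrt_pos r) as hs.
assert (hbr : 0 <= b * sqrt r) by (apply Rmult_le_pos; lra).
unfold UB_inv, halfin_whitt; cbv zeta; fold r.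
pose proof (Rmult_le_compat_l _ _ _ hbr (mills_le _ _ hbr (proj1 hx))).
lra.
Qed.

Lemma ratio_cv (b th : R) : 0 <= b -> th < 1 ->
  exists m, 0 < m /\ forall lam, m <= lam -> th <= lam / (lam + b * sqrt lam).
Proof.
intros hb hth.
(* The claim amounts to th b <= (1 - th) sqrt lam, which holds once sqrt lam >= K; the absolute
   value allows for negative th. *)
pose (K := 1 + Rabs th * b / (1 - th)).
assert (hK : 1 <= K).
{ assert (0 <= Rabs th * b / (1 - th)); [|unfold K; lra].
  apply Rle_mult_inv_pos; [|lra]; apply Rmult_le_pos; [apply Rabs_pos | lra]. }
exists (K * K); split; [nra|]; intros lam hl.
assert (hl0 : 0 < lam) by nra.
pose proof (sqrt_lt_R0 lam hl0) as hs; pose proof (sqrt_sqrt lam ltac:(lra)) as hss.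
assert (hKs : K <= sqrt lam).
{ rewrite <- (sqrt_square K) by lra; apply sqrt_le_1_alt, hl. }
pose proof (staffing_ge b lam hl0 hb) as hn.
apply Rmult_le_reg_r with (lam + b * sqrt lam); [lra|].
unfold Rdiv; rewrite Rmult_assoc, Rinv_l, Rmult_1_r by lra.
assert (h1 : th * b <= (1 - th) * sqrt lam).
{ apply Rle_trans with ((1 - th) * K).
  - unfold K; replace ((1 - th) * (1 + Rabs th * b / (1 - th)))
      with (1 - th + Rabs th * b) by (field; lra).
    pose proof (Rmult_le_compat_r b _ _ hb (Rle_abs th)); lra.
  - apply Rmult_le_compat_l; lra. }
apply Rmult_le_compat_r with (r := sqrt lam) in h1; [|lra].
rewrite (Rmult_assoc (1 - th)), hss in h1; lra.
Qed.

Lemma UB_inv_eventually_ge (b0 b : R) : 0 <= b0 -> b0 < b ->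
  exists m, 0 < m /\ forall lam, m <= lam -> halfin_whitt b0 <= UB_inv b lam.
Proof.
intros h0 hb.
(* The midpoint leaves room twice: for r near 1, b sqrt r still exceeds b1, and the loss 1 - r stays
   within the gap [k] between the values of [halfin_whitt] at b1 and b0. *)
pose (b1 := (b0 + b) / 2).
assert (hlt : halfin_whitt b0 < halfin_whitt b1) by (apply halfin_whitt_lt; unfold b1; lra).
pose (k := halfin_whitt b1 - halfin_whitt b0).
assert (hq : b1 / b < 1).
{ apply Rmult_lt_reg_r with b; [lra|]; unfold Rdiv; rewrite Rmult_assoc, Rinv_l by lra.
  unfold b1; lra. }
assert (hq0 : 0 <= b1 / b) by (apply Rle_mult_inv_pos; unfold b1; lra).
destruct (ratio_cv b (Rmax (1 - k) ((b1 / b) ^ 2))) as [m [hm H]]; [lra | |].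
{ apply Rmax_lub_lt; [unfold k; lra | nra]. }
exists m; split; auto; intros lam hl; specialize (H lam hl).
pose proof (UB_inv_ge_halfin_whitt b lam ltac:(lra) ltac:(lra)) as hU; cbv zeta in hU.
pose proof (Rle_trans _ _ _ (Rmax_l _ _) H) as H1.
pose proof (Rle_trans _ _ _ (Rmax_r _ _) H) as H2.
set (r := lam / (lam + b * sqrt lam)) in *.
assert (h1 : b1 <= b * sqrt r).
{ apply sqrt_le_1_alt in H2; rewrite sqrt_pow2 in H2 by auto.
  apply Rmult_le_compat_l with (r := b) in H2; [|lra].
  replace (b * (b1 / b)) with b1 in H2 by (field; lra); lra. }
assert (h2 : halfin_whitt b1 <= halfin_whitt (b * sqrt r)).
{ destruct h1 as [h1 | <-]; [left; apply halfin_whitt_lt; unfold b1 in *; lra | lra]. }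
unfold k in H1; lra.
Qed.

(** * Optimal solutions and their common limit *)

(** A strictly increasing cost orders the feasible points as the reals do, so its minimizer is the
    least feasible point. *)
Lemma is_optimal_least (c : R -> R) (S : R -> Prop) (m : R) :
  strictly_increasing_on_nonneg c ->
  0 <= m -> S m -> (forall b, 0 <= b -> S b -> m <= b) ->
  is_optimal c S m /\ forall b, is_optimal c S b -> b = m.
Proof.
intros hc hm hS hl; split.
- split; auto; split; auto; intros b hb hSb.
  destruct (hl b hb hSb) as [h | ->]; [left; apply hc; auto | lra].
- intros b [hb [hSb ho]]; destruct (hl b hb hSb) as [h | ->]; auto.
  specialize (ho m hm hS); specialize (hc m b hm h); lra.
Qed.

Theorem theorem4 (c : R -> R) (eps : R) :
  continuous_on_nonneg c ->
  strictly_increasing_on_nonneg c ->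
  0 < eps < 1 ->
  exists betaF betaG : R -> R,
    (forall lam, lam > 0 ->
       is_optimal c (fun b => alpha_tilde b lam <= eps) (betaF lam) /\
       (forall b, is_optimal c (fun b' => alpha_tilde b' lam <= eps) b -> b = betaF lam) /\
       is_optimal c (fun b => UB b lam <= eps) (betaG lam) /\
       (forall b, is_optimal c (fun b' => UB b' lam <= eps) b -> b = betaG lam) /\
       betaF lam <= betaG lam) /\
    exists beta_star : R,
      lim_at_infty betaG beta_star /\ lim_at_infty betaF beta_star.
Proof.
intros _ hc he.
pose (leastF := fun lam m => 0 <= m /\ alpha_tilde m lam <= eps /\
  forall b, 0 <= b -> alpha_tilde b lam <= eps -> m <= b).
pose (leastG := fun lam m => 0 <= m /\ UB m lam <= eps /\
  forall b, 0 <= b -> UB b lam <= eps -> m <= b).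
(* For lam > 0 [epsilon] returns the least feasible point; at other lam the value is arbitrary. *)
pose (betaF := fun lam => epsilon (inhabits 0) (leastF lam)).
pose (betaG := fun lam => epsilon (inhabits 0) (leastG lam)).
assert (hF : forall lam, 0 < lam -> leastF lam (betaF lam)).
{ intros lam hl; apply epsilon_spec, least_alpha_tilde_exists; auto. }
assert (hG : forall lam, 0 < lam -> leastG lam (betaG lam)).
{ intros lam hl; apply epsilon_spec, least_UB_exists; lra. }
assert (hFG : forall lam, 0 < lam -> betaF lam <= betaG lam).
{ intros lam hl; destruct (hF lam hl) as [_ [_ h]]; destruct (hG lam hl) as [g0 [g1 _]].
  apply h; auto; apply alpha_tilde_le_of_UB_le; auto. }
exists betaF, betaG; split.
- intros lam hl; destruct (hF lam hl) as [f0 [f1 f2]]; destruct (hG lam hl) as [g0 [g1 g2]].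
  destruct (is_optimal_least c (fun b => alpha_tilde b lam <= eps) (betaF lam)) as [o1 o2];
    auto.
  destruct (is_optimal_least c (fun b => UB b lam <= eps) (betaG lam)) as [o3 o4]; auto.
  repeat split; auto; try apply o1; try apply o3; apply hFG, hl.
- assert (hK : 1 < / eps) by (rewrite <- Rinv_1; apply Rinv_lt_contravar; lra).
  destruct (halfin_whitt_root (/ eps) hK) as [bs [hbs hroot]].
  (* Feasibility for F forces 1 / eps <= lam I <= H (betaF), and H bs = 1 / eps with H strictly
     increasing. *)
  assert (hlow : forall lam, 0 < lam -> bs <= betaF lam).
  { intros lam hl; destruct (hF lam hl) as [f0 [f1 _]].
    apply alpha_tilde_le_iff in f1; auto.
    pose proof (erl_int_bounds (betaF lam) lam hl f0).
    apply Rnot_lt_le; intros hlt; pose proof (halfin_whitt_lt _ _ f0 hlt); lra. }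
  (* For large lam the point bs + e / 2 is G-feasible, hence bounds betaG; the half leaves the
     strict inequality of the limit. *)
  assert (hup : forall e, e > 0 -> exists M, forall lam, lam >= M ->
    0 < lam /\ betaG lam <= bs + e / 2).
  { intros e hpos.
    destruct (UB_inv_eventually_ge bs (bs + e / 2) hbs ltac:(lra)) as [m [hm H]].
    exists m; intros lam hlam; split; [lra|].
    destruct (hG lam ltac:(lra)) as [_ [_ g]]; apply g; [lra|].
    apply UB_le_iff; try lra; rewrite <- hroot; apply H; lra. }
  exists bs; split; intros e hpos; destruct (hup e hpos) as [M hM]; exists M; intros lam hl;
    destruct (hM lam hl) as [hl0 h]; pose proof (hlow lam hl0); pose proof (hFG lam hl0);
    apply Rabs_def1; lra.
Qed.
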